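(* Let $A=\mathbf{k}((t))$ with Rota-Baxter operator $P$. If $(V,p)$ is a regular RB-module over $(A,P)$ with $\dim_A V=n$ finite, then $(V,p)\cong (A,P)^{\oplus n}$ as RB-modules over $(A,P)$.
   Context: Let $\mathbf{k}$ be a field, $\mathcal{O}=\mathbf{k}[[t]]$, $A=\mathbf{k}((t))=\mathcal{O}\oplus t^{-1}\mathbf{k}[t^{-1}]$, and let $P:A\to A$ be the $\mathbf{k}$-linear projection onto $\mathcal{O}$ with kernel $t^{-1}\mathbf{k}[t^{-1}]$. An RB-module over $(A,P)$ is a pair $(V,p)$ with $V$ an $A$-module and $p:V\to V$ a $\mathbf{k}$-linear map satisfying $P(a)p(x)=p(P(a)x+ap(x)-ax)$ for all $a\in A$, $x\in V$. A homomorphism $(V,p)\to(W,p')$ is an $A$-linear map $f:V\to W$ with $f\circ p=p'\circ f$; it is an isomorphism if $f$ is bijective. $(A,P)^{\oplus n}$ is $A^n$ with $P$ applied in each coordinate. Put $M=p(V)$, which is an $\mathcal{O}$-submodule of $V$, and $\widetilde{M}=\{x\in M\mid Ax\subseteq M\}$. The RB-module $(V,p)$ is called regular if $\widetilde{M}=\{0\}$ and $AM=V$ (where $AM$ is the $A$-span of $M$). *)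

(* Defs.v *)
From HB Require Import structures.
From mathcomp Require Import all_boot all_order all_algebra.
From mathcomp Require Import zify ring.
From mathcomp Require Import boolp classical_sets functions cardinality fsbigop.

Set Implicit Arguments.
Unset Strict Implicit.
Unset Printing Implicit Defensive.

Import Order.TTheory GRing.Theory Num.Theory.
Local Open Scope classical_set_scope.
Local Open Scope ring_scope.

(* A formal Laurent series sum_i f_i t^i in k((t)) is given by its coefficient function i |-> f_i,
   which is zero for all sufficiently negative i. *)
Definition bounded_below (k : fieldType) (f : int -> k) : Prop :=
  exists N : int, forall i : int, i < N -> f i = 0.

Record laurent (k : fieldType) : Type := Laurent {
  lcoef :> int -> k ;
  lcoefP : bounded_below lcoef }.

Section LaurentRing.
Variable k : fieldType.
Local Notation A := (laurent k).
Implicit Types f g h : A.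

HB.instance Definition _ := gen_eqMixin A.
HB.instance Definition _ := gen_choiceMixin A.

Lemma laurentP f g : f =1 g -> f = g.
Proof.
case: f g => [f Pf] [g Pg] /= /funext fg; subst g.
by congr Laurent; exact: Prop_irrelevance.
Qed.

Fact lzero_subproof : bounded_below (fun _ : int => 0 : k).
Proof. by exists 0. Qed.
Definition lzero : A := Laurent lzero_subproof.

Fact lopp_subproof f : bounded_below (fun i => - f i).
Proof. by have [N fN] := lcoefP f; exists N => i /fN ->; rewrite oppr0. Qed.
Definition lopp f : A := Laurent (lopp_subproof f).

Fact ladd_subproof f g : bounded_below (fun i => f i + g i).
Proof.
have [N fN] := lcoefP f; have [M gM] := lcoefP g.
by exists (Num.min N M) => i; rewrite lt_min => /andP[/fN -> /gM ->]; rewrite addr0.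
Qed.
Definition ladd f g : A := Laurent (ladd_subproof f g).

Fact lscale_subproof (c : k) f : bounded_below (fun i => c * f i).
Proof. by have [N fN] := lcoefP f; exists N => i /fN ->; rewrite mulr0. Qed.
Definition lscale (c : k) f : A := Laurent (lscale_subproof c f).

Fact laddA : associative ladd.
Proof. by move=> f g h; apply: laurentP => i /=; rewrite addrA. Qed.
Fact laddC : commutative ladd.
Proof. by move=> f g; apply: laurentP => i /=; rewrite addrC. Qed.
Fact ladd0 : left_id lzero ladd.
Proof. by move=> f; apply: laurentP => i /=; rewrite add0r. Qed.
Fact laddN : left_inverse lzero lopp ladd.
Proof. by move=> f; apply: laurentP => i /=; rewrite addNr. Qed.

HB.instance Definition _ := GRing.isZmodule.Build A laddA laddC ladd0 laddN.

Definition lone_fun (i : int) : k := (i == 0)%:R.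
Fact lone_subproof : bounded_below lone_fun.
Proof. by exists 0 => i i0; rewrite /lone_fun lt_eqF. Qed.
Definition lone : A := Laurent lone_subproof.

(* The Cauchy product; all but finitely many terms of the sum vanish. *)
Definition lmul_fun f g (n : int) : k := \sum_(i \in [set: int]) f i * g (n - i).

Fact lmul_subproof f g : bounded_below (lmul_fun f g).
Proof.
have [N fN] := lcoefP f; have [M gM] := lcoefP g.
exists (N + M) => n nNM; apply: fsbig1 => i _.
have [/fN ->|Ni] := ltP i N; first by rewrite mul0r.
by rewrite gM ?mulr0//; lia.
Qed.
Definition lmul f g : A := Laurent (lmul_subproof f g).

Definition win (N : nat) : seq int := [seq (j%:Z - N%:Z) | j <- iota 0 (N + N)].

Fact mem_win N i : (i \in win N) = (- N%:Z <= i < N%:Z).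
Proof.
apply/mapP/idP => [[j]|/andP[iN Ni]]; first by rewrite mem_iota => ? ->; lia.
by exists (absz (i + N%:Z)); rewrite ?mem_iota; lia.
Qed.

Fact win_uniq N : uniq (win N).
Proof. by rewrite map_inj_uniq ?iota_uniq// => i j; lia. Qed.

Fact fsum_seq (F : int -> k) (r : seq int) : uniq r ->
  (forall i, i \notin r -> F i = 0) ->
  \sum_(i \in [set: int]) F i = \sum_(i <- r) F i.
Proof.
move=> ur Fr; rewrite (fsbigE r)//; last by move=> i _; exact: Fr.
by apply: eq_bigl => i; rewrite in_setT.
Qed.

Fact fsum_win (F : int -> k) N :
  (forall i, N%:Z <= `|i| -> F i = 0) ->
  \sum_(i \in [set: int]) F i = \sum_(i <- win N) F i.
Proof.
move=> FN; apply: fsum_seq; first exact: win_uniq.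
by move=> i; rewrite mem_win => iN; apply: FN; lia.
Qed.

Fact fsum_exchange (F : int -> int -> k) N :
  (forall i j, (N%:Z <= `|i|) || (N%:Z <= `|j|) -> F i j = 0) ->
  \sum_(i \in [set: int]) \sum_(j \in [set: int]) F i j =
  \sum_(j \in [set: int]) \sum_(i \in [set: int]) F i j.
Proof.
move=> FN.
rewrite (@fsum_win _ N); last by move=> i iN; apply: fsbig1 => j _; rewrite FN ?iN.
rewrite [RHS](@fsum_win _ N); last first.
  by move=> j jN; apply: fsbig1 => i _; rewrite FN ?jN ?orbT.
transitivity (\sum_(i <- win N) \sum_(j <- win N) F i j).
  by apply: eq_bigr => i _; apply: fsum_win => j jN; rewrite FN ?jN ?orbT.
rewrite exchange_big; apply: eq_bigr => j _.
by apply/esym/fsum_win => i iN; rewrite FN ?iN.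
Qed.

Fact lowN f : exists N : nat, forall i : int, i < - N%:Z -> f i = 0.
Proof.
have [N fN] := lcoefP f; exists (absz N) => i iN; apply: fN; lia.
Qed.

Fact bij_subl (n : int) : bijective (fun i => n - i).
Proof. by exists (fun i => n - i) => i; rewrite subKr. Qed.

Fact bij_subr (n : int) : bijective (fun i => i - n).
Proof. by exists (fun i => i + n) => i; rewrite ?subrK ?addrK. Qed.

Fact lmulC : commutative lmul.
Proof.
move=> f g; apply: laurentP => n /=; rewrite /lmul_fun.
rewrite (reindex_fsbigT _ _ (bij_subl n)); apply: eq_fsbigr => i _.
by rewrite subKr mulrC.
Qed.

Fact lmulA : associative lmul.
Proof.
move=> f g h; apply: laurentP => n /=; rewrite /lmul_fun /=.
transitivity (\sum_(j \in [set: int]) \sum_(i \in [set: int])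
                f j * (g (i - j) * h (n - i))).
  apply: eq_fsbigr => j _; rewrite /lmul_fun (reindex_fsbigT _ _ (bij_subr j)) mulr_fsumr.
  by apply: eq_fsbigr => i _ /=; congr (_ * (_ * h _)); lia.
have [F fF] := lowN f; have [G gG] := lowN g; have [H hH] := lowN h.
rewrite (@fsum_exchange _ (`|n| + F + G + H).+1); last first.
  move=> j i ij.
  have [/fF ->|Fj] := ltP j (- F%:Z); first by rewrite mul0r.
  have [/gG ->|Gij] := ltP (i - j) (- G%:Z); first by rewrite mul0r mulr0.
  by rewrite [h _]hH ?mulr0//; lia.
apply: eq_fsbigr => i _; rewrite /lmul_fun mulr_fsuml.
by apply: eq_fsbigr => j _; rewrite mulrA.
Qed.

Fact lmul1 : left_id lone lmul.
Proof.
move=> f; apply: laurentP => n /=; rewrite /lmul_fun (@fsum_seq _ [:: 0])//=.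
  by rewrite big_seq1 /lone_fun eqxx mul1r subr0.
by move=> i; rewrite inE /lone_fun => /negPf ->; rewrite mul0r.
Qed.

Fact lmulDl : left_distributive lmul +%R.
Proof.
move=> f g h; apply: laurentP => n /=; rewrite /lmul_fun.
have [F fF] := lowN f; have [G gG] := lowN g; have [H hH] := lowN h.
have win_ok (u : A) : (forall i : int, i < - (F + G)%:Z -> u i = 0) ->
    \sum_(i \in [set: int]) u i * h (n - i) =
    \sum_(i <- win (`|n| + F + G + H).+1) u i * h (n - i).
  move=> u0; apply: fsum_win => i iN.
  have [/u0 ->|ui] := ltP i (- (F + G)%:Z); first by rewrite mul0r.
  by rewrite hH ?mulr0//; lia.
rewrite !win_ok.
- by rewrite -big_split; apply: eq_bigr => i _; exact: mulrDl.
- by move=> i iN; apply: gG; lia.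
- by move=> i iN; apply: fF; lia.
- by move=> i iN; rewrite /= fF ?gG ?addr0//; lia.
Qed.

Fact lone_neq0 : lone != 0 :> A.
Proof.
apply/eqP => /(congr1 (fun f : A => f 0)) /=; rewrite /lone_fun eqxx.
by move/eqP; rewrite oner_eq0.
Qed.

HB.instance Definition _ :=
  GRing.Zmodule_isComNzRing.Build A lmulA lmulC lmul1 lmulDl lone_neq0.

Fact lscaleA (a b : k) f : lscale a (lscale b f) = lscale (a * b) f.
Proof. by apply: laurentP => i /=; rewrite mulrA. Qed.
Fact lscale1 : left_id 1 lscale.
Proof. by move=> f; apply: laurentP => i /=; rewrite mul1r. Qed.
Fact lscaleDr : right_distributive lscale +%R.
Proof. by move=> a f g; apply: laurentP => i /=; rewrite mulrDr. Qed.
Fact lscaleDl f : {morph lscale^~ f : a b / a + b}.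
Proof. by move=> a b; apply: laurentP => i /=; rewrite mulrDl. Qed.

HB.instance Definition _ :=
  GRing.Zmodule_isLmodule.Build k A lscaleA lscale1 lscaleDr lscaleDl.

Fact lscaleAl (a : k) f g : a *: (f * g) = (a *: f) * g.
Proof.
apply: laurentP => n; rewrite /= /lmul_fun mulr_fsumr.
by apply: eq_fsbigr => i _; rewrite /= mulrA.
Qed.

HB.instance Definition _ := GRing.Lmodule_isLalgebra.Build k A lscaleAl.
HB.instance Definition _ := GRing.Lalgebra_isComAlgebra.Build k A.

Fact lorder f : f != 0 -> exists m : int,
  f m != 0 /\ forall i : int, i < m -> f i = 0.
Proof.
move=> f0; have [N fN] := lowN f.
have exn : exists n : nat, f (n%:Z - N%:Z) != 0.
  apply: contrapT => nex; move/eqP: f0; apply; apply: laurentP => i.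
  have [/fN //|Ni] := ltP i (- N%:Z).
  apply/eqP; apply: contrapT => /negP fi; apply: nex.
  by exists (absz (i + N%:Z)); rewrite gez0_abs ?addrK//; lia.
case: (ex_minnP exn) => n fn nmin; exists (n%:Z - N%:Z); split=> // i iN.
have [/fN //|Ni] := ltP i (- N%:Z).
apply/eqP; apply: contraT => fi.
have := nmin (absz (i + N%:Z)); rewrite gez0_abs ?addrK; last lia.
by move=> /(_ fi); lia.
Qed.

(* The coefficients of the inverse of the power series u, if u 0 != 0. *)
Definition invs_next (u : nat -> k) (s : seq k) : k :=
  (u 0%N)^-1 * ((size s == 0%N)%:R - \sum_(j < size s) s`_j * u (size s - j)%N).
Definition invs (u : nat -> k) n := iter n (fun s => rcons s (invs_next u s)) [::].

Fact size_invs u n : size (invs u n) = n.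
Proof. by elim: n => //= n IH; rewrite size_rcons IH. Qed.

Fact nth_invs u n m : (n < m)%N -> (invs u m)`_n = (invs u n.+1)`_n.
Proof.
elim: m => // m IH; rewrite ltnS leq_eqVlt => /orP[/eqP -> //|nm].
by rewrite /= nth_rcons size_invs nm IH.
Qed.

Fact invsP u n : u 0%N != 0 ->
  \sum_(j < n.+1) (invs u j.+1)`_j * u (n - j)%N = (n == 0%N)%:R.
Proof.
move=> u0; rewrite big_ord_recr /= subnn nth_rcons size_invs ltnn eqxx.
rewrite /invs_next size_invs mulrAC mulVf// mul1r addrC.
under [X in _ - X]eq_bigr => j _ do rewrite nth_invs ?ltn_ord//.
by rewrite subrK.
Qed.

Fact linv_exists f : f != 0 -> exists g, g * f = 1.
Proof.
move=> /lorder[m [fm fmin]].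
pose u (n : nat) := f (m + n%:Z).
pose v (n : nat) := (invs u n.+1)`_n.
pose w (i : int) := if i < - m then 0 else v (absz (i + m)).
have wb : bounded_below w by exists (- m) => i; rewrite /w => ->.
exists (Laurent wb); apply: laurentP => n /=; rewrite /lmul_fun /= /lone_fun.
have [n0|n0] := ltP n 0.
  rewrite fsbig1 => [|i _]; first by rewrite lt_eqF.
  rewrite /w; case: ltP => im; first by rewrite mul0r.
  by rewrite fmin ?mulr0//; lia.
case: n n0 => // n _; rewrite (@fsum_seq _ [seq (j%:Z - m) | j <- iota 0 n.+1]).
- rewrite big_map -/(index_iota 0 n.+1) big_mkord.
  rewrite -[RHS](@invsP u n); last by rewrite /u addr0.
  apply: eq_bigr => j _; rewrite /w ifF; last lia.
  by rewrite subrK absz_nat /u; congr (_ * f _); have := ltn_ord j; lia.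
- by rewrite map_inj_uniq ?iota_uniq// => i j; lia.
- move=> i /mapP nex; rewrite /w; case: ltP => im; first by rewrite mul0r.
  rewrite fmin ?mulr0// ltNge; apply/negP => mi; apply: nex.
  by exists (absz (i + m)); rewrite ?mem_iota; lia.
Qed.

Definition linv f : A := xget 0 [set g : A | g * f = 1].

Fact lmulVf f : f != 0 -> linv f * f = 1.
Proof. by move=> /linv_exists[g gf]; apply: (xgetPex 0 (P := [set g : A | g * f = 1])); exists g. Qed.

Fact linv0 : linv 0 = 0.
Proof.
apply: xgetPN => g /=; rewrite mulr0 => /esym/eqP; exact/negP/oner_neq0.
Qed.

HB.instance Definition _ := GRing.ComNzRing_isField.Build A lmulVf linv0.

(* The projection onto k[[t]] with kernel t^-1 k[t^-1] *)

Fact lproj_subproof f : bounded_below (fun i => if 0 <= i then f i else 0).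
Proof. by exists 0 => i i0; rewrite leNgt i0. Qed.
Definition lproj f : A := Laurent (lproj_subproof f).

Fact lproj_linear : linear lproj.
Proof.
by move=> a f g; apply: laurentP => i /=; case: ifP => // _; rewrite mulr0 addr0.
Qed.

HB.instance Definition _ := GRing.isLinear.Build k A A _ lproj lproj_linear.

End LaurentRing.

Section RBModules.
Variables (k : fieldType) (A : algType k).

(* The action of a scalar c of k on an A-module V is that of c%:A = c *: 1. *)
Definition klinear (V W : lmodType A) (p : V -> W) : Prop :=
  forall (c : k) (x y : V), p (c%:A *: x + y) = c%:A *: p x + p y.

Definition is_rbmodule (P : A -> A) (V : lmodType A) (p : V -> V) : Prop :=
  klinear p /\
  forall (a : A) (x : V), P a *: p x = p (P a *: x + a *: p x - a *: x).

Definition rb_iso (V W : lmodType A) (p : V -> V) (p' : W -> W) : Prop :=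
  exists f : {linear V -> W}, (forall x, f (p x) = p' (f x)) /\ bijective f.

Definition Aspan (V : lmodType A) (M : set V) : set V :=
  [set v | exists (m : nat) (a : 'I_m -> A) (x : 'I_m -> V),
     (forall i, M (x i)) /\ v = \sum_(i < m) a i *: x i].

(* The largest A-submodule contained in p(V), for an RB-module (V, p). *)
Definition Mtilde (V : lmodType A) (p : V -> V) : set V :=
  [set x | range p x /\ forall a : A, range p (a *: x)].

Definition rb_regular (V : lmodType A) (p : V -> V) : Prop :=
  Mtilde p = [set 0] /\ Aspan (range p) = [set: V].

End RBModules.

(* The operator of (A, P)^n on A^n, the space of row vectors. *)
Definition lproj_row (k : fieldType) (n : nat) :
    'rV[laurent k]_n -> 'rV[laurent k]_n :=
  map_mx (@lproj k).

Section LaurentRB.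
Variable k : fieldType.
Implicit Types (a b : laurent k).

Fact lproj_idem a : lproj (lproj a) = lproj a.
Proof. by apply: laurentP => i /=; have [] := lerP 0 i. Qed.

(* Products of elements of k[[t]] and of t^-1 k[t^-1] stay there. *)
Fact lproj_mul a b : lproj (lproj a * lproj b) = lproj a * lproj b.
Proof.
apply: laurentP => n /=; have [//|n0] := lerP 0 n.
rewrite /lmul_fun fsbig1// => i _ /=.
have [i0|i0] := lerP 0 i; last by rewrite mul0r.
by rewrite ifF ?mulr0//; lia.
Qed.

Fact lproj_mulN a b : lproj ((a - lproj a) * (b - lproj b)) = 0.
Proof.
apply: laurentP => n /=; have [n0|//] := lerP 0 n.
rewrite /lmul_fun fsbig1// => i _ /=.
have [i0|i0] := lerP 0 i; first by rewrite subrr mul0r.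
by rewrite ifT ?subrr ?mulr0//; lia.
Qed.

Lemma lproj_rota_baxter a b :
  lproj a * lproj b = lproj (lproj a * b + a * lproj b - a * b).
Proof.
rewrite -lproj_mul -[LHS]subr0 -(lproj_mulN a b) -linearB /=; congr lproj.
by ring.
Qed.

Lemma lproj_row_rbmodule n : is_rbmodule (@lproj k) (@lproj_row k n).
Proof.
split=> [c x y|a x]; rewrite /lproj_row; apply/rowP => i; rewrite !mxE.
  by rewrite -!scalerAl !mul1r linearP.
by rewrite lproj_rota_baxter.
Qed.

End LaurentRB.

(* Main.v *)
Require Import Defs.
From HB Require Import structures.
From mathcomp Require Import all_boot all_order all_algebra.
From mathcomp Require Import zify.
From mathcomp Require Import boolp classical_sets functions cardinality fsbigop.

Import Order.TTheory GRing.Theory.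
Local Open Scope ring_scope.

Set Implicit Arguments.
Unset Strict Implicit.
Unset Printing Implicit Defensive.

(** Put [M = p(V)] and [K = ker p]. Taking [a = 1] in the module identity shows
    that [p] is idempotent, so [V = M (+) K]; the identity then says that [M] is
    stable under [k[[t]]] and [K] under [t^-1 k[t^-1]]. What is wanted is an
    [A]-basis of [V] made of vectors [e] on whose lines [p] acts as [P], that is,
    [p (a e) = P(a) e] for all [a]: taking coordinates in it is the isomorphism.

    The vectors of [E = M /\ tK] have this property ([rb_adapted]). Geometrically,
    [M] and [tK] glue to a vector bundle on the projective line whose twist
    by [-1], glued from [M] and [K], has no cohomology because [V = M (+) K]; such a
    bundle is trivial, and [E] is its space of global sections.

    Since [V] is finite-dimensional, there is a maximal [A]-free family [e] in [E].
    By maximality every [x] in [E] is a combination of the [e_i] with coefficients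
    [a_i] in [A], and comparing with [p x = x] and [p (t^-1 x) = 0] forces the [a_i]
    into the intersection of [k[[t]]] and [k[t^-1]], which is [k] ([adapted_coord]).

    It remains to see that [e] spans [V]. As [V = tM (+) tK] and [M] contains [tM], one
    has [M = E (+) tM] ([lead_adapted]), so that [m] in [M] expands successively as
    [x_0 + t x_1 + t^2 x_2 + ...] with all [x_j] in [E]. The [x_j] have coordinates
    in [k], so the coordinates of this series are power series, and its sum
    [s] makes sense in the span of [e]. The difference [m - s] lies in [t^j M]
    for every [j] ([expansion_divisible]), hence its whole [A]-line lies in [M],
    and it vanishes by the first half of regularity ([divisible_eq0]). Thus [M]
    lies in the span of [e], and the second half, [AM = V], concludes. *)

(** * Monomials in k((t)) *)

Section Monomials.
Variable k : fieldType.
Implicit Types (a b : laurent k) (i j n : int).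

Lemma lproj1 : lproj (1 : laurent k) = 1.
Proof.
by apply: laurentP => n /=; case: leP => // n0; rewrite /lone_fun lt_eqF.
Qed.

Fact tpow_subproof i : bounded_below (fun n => (n == i)%:R : k).
Proof. by exists i => n ni; rewrite lt_eqF. Qed.

Definition tpow i : laurent k := Laurent (tpow_subproof i).

Lemma tpow_mulE i a n : (tpow i * a) n = a (n - i).
Proof.
rewrite /= /lmul_fun (@fsum_seq _ _ [:: i])//=; first by rewrite big_seq1 eqxx mul1r.
by move=> j; rewrite inE => /negPf ->; rewrite mul0r.
Qed.

Lemma tpow0 : tpow 0 = 1. Proof. exact: laurentP. Qed.

Lemma tpowD i j : tpow (i + j) = tpow i * tpow j.
Proof.
apply: laurentP => n; rewrite tpow_mulE /=; congr (_%:R); congr nat_of_bool.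
by apply/eqP/eqP; lia.
Qed.

Lemma laddE a b n : (a + b) n = a n + b n. Proof. by []. Qed.

Lemma lconstE (c : k) n : (c%:A : laurent k) n = c * (n == 0)%:R.
Proof. by []. Qed.

Lemma lproj_tpow i : 0 <= i -> lproj (tpow i) = tpow i.
Proof.
by move=> i0; apply: laurentP => n /=; case: ifP => // n0; case: eqP => //; lia.
Qed.

(** Multiplying by [t] carries the coefficient of [t^-1] into [k[[t]]]: this one
    coefficient is the whole failure of [P] to commute with [t]. *)
Lemma lproj_shift a :
  tpow (-1) * lproj (tpow 1 * a) = lproj a + (a (-1))%:A * tpow (-1).
Proof.
apply: laurentP => n; rewrite [_%:A * _]mulrC laddE !tpow_mulE lconstE !opprK.
have -> : lproj (tpow 1 * a) (n + 1) = if 0 <= n + 1 then a n else 0.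
  by have -> : a n = (tpow 1 * a) (n + 1) by rewrite tpow_mulE addrK.
rewrite /=; have [n0|n0|/eqP n0] := ltgtP (n + 1) 0.
- by rewrite mulr0 addr0 ifF//; lia.
- by rewrite mulr0 addr0 ifT//; lia.
- by move: n0; rewrite addr_eq0 => /eqP ->; rewrite mulr1 add0r.
Qed.

(** The second hypothesis puts [a] in [k[t^-1]], whose intersection with [k[[t]]]
    is [k]. *)
Lemma lconst_of_proj a :
  lproj a = a -> lproj (tpow (-1) * a) = 0 -> a = (a 0)%:A.
Proof.
move=> a0 a1; apply: laurentP => n; rewrite lconstE.
have [n0|n0|->] := ltgtP n 0; last by rewrite mulr1.
  by rewrite mulr0 -a0 /= leNgt n0.
rewrite mulr0; have := congr1 (fun f : laurent k => f (n - 1)) a1.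
rewrite /lproj /= -[lmul_fun _ _ _]/((tpow (-1) * a) (n - 1)) tpow_mulE ifT; last lia.
by rewrite opprK subrK.
Qed.

Lemma tpow_mul_integral a : exists m : nat, lproj (tpow m%:Z * a) = tpow m%:Z * a.
Proof.
have [N aN] := lowN a; exists N; apply: laurentP => n.
rewrite [LHS]/=; case: leP => // n0.
by rewrite tpow_mulE aN//; lia.
Qed.

Fact pseries_subproof (c : nat -> k) :
  bounded_below (fun n : int => if 0 <= n then c (absz n) else 0).
Proof. by exists 0 => n n0; rewrite leNgt n0. Qed.

Definition pseries (c : nat -> k) : laurent k := Laurent (pseries_subproof c).

Lemma lproj_pseries c : lproj (pseries c) = pseries c.
Proof. by apply: laurentP => n /=; have [] := leP 0 n. Qed.

Lemma pseries_recl c : pseries c = (c 0%N)%:A + tpow 1 * pseries (fun m : nat => c m.+1).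
Proof.
apply: laurentP => n; rewrite laddE tpow_mulE lconstE /=.
have [n0|n0|->] := ltgtP n 0; last by rewrite mulr1 addr0.
  by rewrite mulr0 add0r ifF//; lia.
by rewrite mulr0 add0r ifT; [congr c; lia | lia].
Qed.

End Monomials.

(** * Vectors on which p acts as P *)

Section RotaBaxterModule.
Variables (k : fieldType) (V : vectType (laurent k)) (p : V -> V).
Hypothesis rbp : is_rbmodule (@lproj k) p.
Implicit Types (a : laurent k) (x y v e : V).

Lemma rbD x y : p (x + y) = p x + p y.
Proof. by have [lin _] := rbp; have := lin 1 x y; rewrite !scale1r. Qed.

Lemma rb0 : p 0 = 0.
Proof. by apply: (@addrI _ (p 0)); rewrite -rbD !addr0. Qed.

Lemma rbN x : p (- x) = - p x.
Proof. by apply: (@addrI _ (p x)); rewrite -rbD !subrr rb0. Qed.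

Lemma rbZ (c : k) x : p (c%:A *: x) = c%:A *: p x.
Proof. by have [lin _] := rbp; have := lin c x 0; rewrite rb0 !addr0. Qed.

Lemma rb_sum n (F : 'I_n -> V) : p (\sum_i F i) = \sum_i p (F i).
Proof. exact: (big_morph p rbD rb0). Qed.

Lemma rb_idem x : p (p x) = p x.
Proof.
have [_ /(_ 1 x)] := rbp.
by rewrite lproj1 !scale1r addrAC subrr add0r => /esym.
Qed.

Lemma rb_range x : range p x <-> p x = x.
Proof. by split=> [[y _ <-]|<-]; [exact: rb_idem | exists x]. Qed.

Lemma rb_integral a x : lproj a = a -> p x = x -> p (a *: x) = a *: x.
Proof.
move=> aO xM; have [_ /(_ a x)] := rbp.
by rewrite aO xM addrK => /esym.
Qed.

(** Membership in [M /\ tK], where [M] is the image of [p] and [K] its kernel. *)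
Definition adapted e := p e = e /\ p (tpow k (-1) *: e) = 0.

(** The module identity for the scalar [t a] and the vector [t^-1 e] of [ker p]
    reads [0 = p (P(t a) t^-1 e - a e)], and [P(t a) t^-1] differs from [P(a)] by
    a [k]-multiple of [t^-1]. *)
Lemma rb_adapted e a : adapted e -> p (a *: e) = lproj a *: e.
Proof.
move=> [eM eK].
have [_ /(_ (tpow k 1 * a) (tpow k (-1) *: e))] := rbp.
rewrite eK !scaler0 addr0 !scalerA (mulrC (lproj _)) lproj_shift.
rewrite [_ * a]mulrC -[a * _ * _]mulrA -tpowD addrN tpow0 mulr1.
rewrite scalerDl -scalerA !rbD rbN rbZ eK scaler0 addr0 (rb_integral (lproj_idem a) eM).
by move/esym/eqP; rewrite subr_eq0 => /eqP.
Qed.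

(** The component of [x] in [M /\ tK] along [M = (M /\ tK) (+) tM], obtained by
    splitting [t^-1 x] along [V = M (+) ker p] and multiplying back by [t]. *)
Lemma lead_adapted x : p x = x ->
  adapted (x - tpow k 1 *: p (tpow k (-1) *: x)).
Proof.
move=> xM; split; rewrite ?scalerBr ?scalerA -?tpowD ?addNr ?tpow0 ?scale1r rbD rbN.
  by rewrite xM (rb_integral _ (rb_idem _)) ?lproj_tpow.
by rewrite rb_idem subrr.
Qed.

(** * Expansion along a maximal free family *)

Section MaximalFamily.
Variables (n : nat) (e : n.-tuple V).
Hypotheses (e_free : free e) (e_adapted : forall i : 'I_n, adapted e`_i).

Lemma rb_comb (a : 'I_n -> laurent k) :
  p (\sum_i a i *: e`_i) = \sum_i lproj (a i) *: e`_i.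
Proof.
by rewrite rb_sum; apply: eq_bigr => i _; exact: rb_adapted.
Qed.

Lemma coord_rb i v : v \in <<e>>%VS -> coord e i (p v) = lproj (coord e i v).
Proof. by move=> /coord_span ve; rewrite {1}ve rb_comb coord_sum_free. Qed.

(** On the span of [e] the operator acts as [P] on coordinates, so the equations
    that define [adapted] hold for each coordinate separately. *)
Lemma adapted_coord i x : x \in <<e>>%VS -> adapted x ->
  coord e i x = ((coord e i x) 0)%:A.
Proof.
move=> xe [xM xK]; apply: lconst_of_proj; first by rewrite -coord_rb ?xM.
by rewrite -[_ * _]linearZ -coord_rb ?memvZ// xK linear0.
Qed.

Hypothesis e_max : forall x, adapted x -> x \in <<e>>%VS.

Let lead x := x - tpow k 1 *: p (tpow k (-1) *: x).
Let tail x := p (tpow k (-1) *: x).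

(** The sum of the series [lead x + t lead (tail x) + t^2 lead (tail (tail x)) + ...],
    taken coordinate by coordinate: for [x] in [M] every [lead] has its coordinates
    in [k], so the [i]-th ones are the coefficients of a power series. *)
Definition expansion x : V :=
  \sum_i pseries (fun j => (coord e i (lead (iter j tail x))) 0) *: e`_i.

Lemma expansion_tail x : p x = x ->
  x - expansion x = tpow k 1 *: (tail x - expansion (tail x)).
Proof.
move=> xM; have := lead_adapted xM; rewrite -/(lead x) => xE.
have -> : expansion x = lead x + tpow k 1 *: expansion (tail x).
  rewrite {1}/expansion; under eq_bigr => i _ do rewrite pseries_recl scalerDl -scalerA.
  rewrite big_split /= scaler_sumr; congr (_ + _).
    rewrite [RHS](coord_span (e_max xE)).
    by apply: eq_bigr => i _; rewrite -(adapted_coord _ (e_max xE) xE).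
  apply: eq_bigr => i _; do 2![congr (_ *: _)]; congr pseries.
  by apply/funext => j; rewrite -iterS iterSr.
by rewrite /lead -/(tail x) scalerBr opprD opprB addrA addrCA subrr addr0.
Qed.

Lemma expansion_divisible x j : p x = x ->
  exists2 y, p y = y & x - expansion x = tpow k j%:Z *: y.
Proof.
elim: j x => [|j IH] x xM.
  exists (x - expansion x); last by rewrite tpow0 scale1r.
  rewrite rbD rbN xM rb_comb; congr (_ - _).
  by apply: eq_bigr => i _; rewrite lproj_pseries.
have [y yM xy] := IH (tail x) (rb_idem _); exists y => //.
by rewrite expansion_tail// xy scalerA -tpowD intS.
Qed.

End MaximalFamily.

(** * Existence of an adapted basis *)

(** A vector divisible by every [t^j] within [M] spans a line inside [M]: every [a]
    in [A] becomes integral after multiplication by some [t^j]. *)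
Lemma divisible_eq0 x : Mtilde p = [set 0]%classic ->
  (forall j : nat, exists2 y, p y = y & x = tpow k j%:Z *: y) -> x = 0.
Proof.
move=> M0 xdiv; suff: Mtilde p x by rewrite M0.
have xM a : range p (a *: x).
  have [j aO] := tpow_mul_integral a; have [y yM ->] := xdiv j.
  by rewrite scalerA mulrC; apply/rb_range/rb_integral.
by split=> //; rewrite -[x]scale1r.
Qed.

Lemma exists_max_adapted : exists (n : nat) (e : n.-tuple V),
  [/\ free e, forall i : 'I_n, adapted e`_i & forall x, adapted x -> x \in <<e>>%VS].
Proof.
pose Q m := `[< exists s : m.-tuple V, free s /\ forall i : 'I_m, adapted s`_i >].
have exQ : exists m, Q m.
  by exists 0%N; apply/asboolP; exists [tuple]; split; [exact: nil_free | case].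
have Q_le m : Q m -> (m <= \dim {:V})%N.
  by move=> /asboolP[s [/eqP + _]]; rewrite size_tuple => <-; exact/dimvS/subvf.
case: (ex_maxnP exQ Q_le) => m /asboolP[s [s_free sE]] m_max.
exists m, s; split=> // x xE; apply: contraT => xs.
have /m_max : Q m.+1; last by rewrite ltnn.
apply/asboolP; exists [tuple of x :: s]; split; first by rewrite free_cons xs.
by case=> -[|i] //= im; exact: (sE (Ordinal (im : i < m)%N)).
Qed.

Lemma adapted_basis : rb_regular p -> exists (n : nat) (e : n.-tuple V),
  basis_of {:V} e /\ forall i : 'I_n, adapted e`_i.
Proof.
move=> [M0 Mspan]; have [n [e [e_free eE e_max]]] := exists_max_adapted.
have Me x : p x = x -> x \in <<e>>%VS.
  move=> xM; suff -> : x = expansion e x.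
    by apply: memv_suml => i _; rewrite memvZ// memv_span// mem_nth ?size_tuple.
  apply/eqP; rewrite -subr_eq0; apply/eqP; apply: divisible_eq0 => // j.
  exact: expansion_divisible.
exists n, e; split=> //; rewrite /basis_of e_free andbT eqEsubv subvf.
apply/subvP => v _; have : Aspan (range p) v by rewrite Mspan.
move=> [m [a [x [xM ->]]]]; apply: memv_suml => i _.
by rewrite memvZ// Me//; apply/rb_range.
Qed.

End RotaBaxterModule.

Theorem theorem4p4 (k : fieldType) (n : nat) (V : vectType (laurent k))
    (p : V -> V) :
  is_rbmodule (@lproj k) p -> rb_regular p -> (\dim {:V})%N = n ->
  rb_iso p (@lproj_row k n).
Proof.
move=> rbp rbr dimV; have [m [e [eV eE]]] := adapted_basis rbp rbr.
have mn : m = n by rewrite -dimV (size_basis eV).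
subst m; have e_free := basis_free eV.
pose f (v : V) : 'rV[laurent k]_n := \row_i coord e i v.
have f_lin : linear f by move=> a x y; apply/rowP => i; rewrite !mxE linearP.
pose F : {linear V -> 'rV[laurent k]_n} := HB.pack f (GRing.isLinear.Build _ _ _ _ f f_lin).
exists F; split=> [x|].
  apply/rowP => i; rewrite !mxE (coord_rb rbp e_free eE)//.
  by rewrite (span_basis eV) memvf.
exists (fun r : 'rV_n => \sum_i r 0 i *: e`_i) => [x|r] /=.
  rewrite [RHS](coord_basis eV (memvf x)).
  by apply: eq_bigr => i _; rewrite mxE.
by apply/rowP => i; rewrite mxE coord_sum_free.
Qed.
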